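(* If $u, v : [a,b] \to \mathbb{R}$ are differentiable on $[a,b]$ with continuous derivatives, then $uv$ is differentiable on $[a,b]$ with \[ \frac{d}{dx}\bigl(u(x)v(x)\bigr) = \frac{d}{dx}u(x)\,v(x) + u(x)\,\frac{d}{dx}v(x) \] for every $x \in [a,b]$.
   Context: The derivative of $F : [a,b]\to\mathbb{R}$ at $x \in (a,b)$ is $\frac{d}{dx}F(x) := \lim_{h\to 0} \frac{F(x+h)-F(x)}{h}$ when the limit exists; at the endpoints $a$ and $b$ the corresponding one-sided limits are used. *)

(* Defs.v *)
From HB Require Import structures.
From mathcomp Require Import all_boot all_order all_algebra.
From mathcomp Require Import all_classical all_reals all_analysis.

Set Implicit Arguments.
Unset Strict Implicit.
Unset Printing Implicit Defensive.

Import Order.TTheory GRing.Theory Num.Theory.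
Import numFieldNormedType.Exports.

Local Open Scope classical_set_scope.
Local Open Scope ring_scope.

(* A function [a, b] -> R is represented by a total function F : R -> R; for
   a < b and x in [a, b], nothing below depends on the values of F outside
   [a, b], since x + h stays in [a, b] for h in a small enough set of the
   filter. *)

Definition increment_filter (R : realType) (a b x : R) : set_system R :=
  if x == a then (0 : R)^'+ else if x == b then (0 : R)^'- else (0 : R)^'.

Definition diff_quotient (R : realType) (F : R -> R) (x h : R) : R :=
  (F (x + h) - F x) / h.

Definition derivable_at_on (R : realType) (a b : R) (F : R -> R) (x : R) : Prop :=
  cvg (diff_quotient F x h @[h --> increment_filter a b x]).

Definition derive_on (R : realType) (a b : R) (F : R -> R) (x : R) : R :=
  lim (diff_quotient F x h @[h --> increment_filter a b x]).

Definition derivable_on (R : realType) (a b : R) (F : R -> R) : Prop :=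
  forall x, x \in `[a, b] -> derivable_at_on a b F x.

Lemma derive_on_interior (R : realType) (a b : R) (F : R -> R) (x : R) :
  a < x < b -> derive_on a b F x = derive1 F x.
Proof.
move=> /andP[ax xb]; rewrite /derive_on /increment_filter (gt_eqF ax) (lt_eqF xb).
suff -> : diff_quotient F x = fun h => h^-1 *: (F (h + x) - F x) by [].
by apply/funext => h; rewrite /diff_quotient [x + h]addrC mulrC.
Qed.

(* Main.v *)
Require Import Defs.
From HB Require Import structures.
From mathcomp Require Import all_boot all_order all_algebra.
From mathcomp Require Import all_classical all_reals all_analysis.
From mathcomp Require Import ring.
Import Order.TTheory GRing.Theory Num.Theory.
Import numFieldNormedType.Exports.
Local Open Scope classical_set_scope.
Local Open Scope ring_scope.

(** Writing each increment as [h] times its quotient, the quotient of the product is Qu v(x) + u(x)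
    Qv + h Qu Qv ([diff_quotientM]). Qu and Qv converge, so the cross term tends to 0 with [h]. One
    argument serves interior points and endpoints, since it uses only that [increment_filter] is a
    proper filter converging to 0. *)

#[local] Instance increment_filter_proper (R : realType) (a b x : R) :
  ProperFilter (increment_filter a b x).
Proof. by rewrite /increment_filter; case: ifP => _; [|case: ifP => _]; exact _. Qed.

(** Each branch is the neighbourhood filter of 0 restricted to a subset, hence finer than it. *)
Lemma cvg_increment_filter (R : realType) (a b x : R) :
  h @[h --> increment_filter a b x] --> (0 : R).
Proof.
rewrite /increment_filter; case: ifP => _; [|case: ifP => _];
  exact: cvg_within.
Qed.

(* No hypothesis [h != 0]: every quotient is [0] at [h = 0]. *)
Lemma diff_quotientM (R : realType) (u v : R -> R) (x h : R) :
  diff_quotient (fun y => u y * v y) x h =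
    diff_quotient u x h * v x + u x * diff_quotient v x h
    + h * (diff_quotient u x h * diff_quotient v x h).
Proof.
rewrite /diff_quotient; have [->|h0] := eqVneq h 0; last by field.
by rewrite invr0 !mulr0 !mul0r !addr0.
Qed.

(** Convergence to an explicit limit yields both existence and value of the derivative. *)
Lemma cvg_diff_quotientM (R : realType) (a b : R) (u v : R -> R) (x : R) :
  derivable_at_on a b u x -> derivable_at_on a b v x ->
  diff_quotient (fun y => u y * v y) x h @[h --> increment_filter a b x] -->
    derive_on a b u x * v x + u x * derive_on a b v x.
Proof.
move=> du dv; rewrite (funext (diff_quotientM _ u v x)) -[X in _ --> X]addr0.
(* The added 0 becomes the limit of the cross term, factor by factor. *)
rewrite -(mul0r (derive_on a b u x * derive_on a b v x)).
(* [du] and [dv] unfold to convergence towards the [lim] that defines [derive_on]. *)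
apply: cvgD; first by apply: cvgD; apply: cvgM => //; exact: cvg_cst.
by apply: cvgM; [exact: cvg_increment_filter|exact: cvgM].
Qed.

Theorem corollary7p2 (R : realType) (a b : R) (hab : a < b) (u v : R -> R)
  (hu : derivable_on a b u) (hv : derivable_on a b v)
  (hu' : {within `[a, b], continuous (derive_on a b u)})
  (hv' : {within `[a, b], continuous (derive_on a b v)}) :
  derivable_on a b (fun x => u x * v x) /\
  forall x : R, x \in `[a, b] ->
    derive_on a b (fun y => u y * v y) x =
      derive_on a b u x * v x + u x * derive_on a b v x.
Proof.
have cuv x (xab : x \in `[a, b]) :=
  cvg_diff_quotientM _ _ _ _ _ _ (hu x xab) (hv x xab).
split=> x /cuv H; first exact: cvgP H.
(* Limits are unique: the filter is proper and [R] is Hausdorff. *)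
exact: cvg_lim H.
Qed.
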